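(* Let $k\in\{1,2\}$ and let $\eta$ be a sewable $(k-1)$-germ in $D$ such that the $k$-germ $\delta\eta$ is sewable. Then $\delta\operatorname{sew}\eta=\operatorname{sew}\delta\eta$. In particular, if $\eta$ is regular (so that $\mathsf{d}\eta:=\delta\eta$ is regular), then $$\int_{\partial S}\eta=\int_S\mathsf{d}\eta\qquad\text{for every }S\in\operatorname{Simp}^k(D).$$
   Context: Let $D\subseteq\mathbb{R}^d$ be a set. A $k$-simplex in $D$ is a tuple $S=[p_0p_1\ldots p_k]\in D^{k+1}$ with $\operatorname{conv}(S)\subseteq D$; $\operatorname{Simp}^k(D)$ is the set of $k$-simplices, and $\operatorname{Chain}^k(D)$ the real vector space generated by them. A $k$-germ in $D$ is a function $\omega:\operatorname{Simp}^k(D)\to\mathbb{R}$, written $\omega_S=\langle S,\omega\rangle$ and extended linearly to chains. The boundary is $\partial[p_0\ldots p_k]=\sum_{i=0}^k(-1)^i[p_0\ldots\hat p_i\ldots p_k]$, and $\langle S,\delta\omega\rangle:=\langle\partial S,\omega\rangle$ for $S\in \operatorname{Simp}^{k+1}(D)$. For $S=[p_0\ldots p_k]$ with $k\ge 1$, $\operatorname{vol}_k(S)=\frac1{k!}\sqrt{\det(PP^T)}$, where $P$ is the matrix with rows $p_i-p_0$, $i=1,\dots,k$. A $k$-germ $\omega$ is nonatomic if $\omega_S=0$ whenever $\operatorname{vol}_k(S)=0$ (a void condition for $k=0$); it is closed on $k$-planes if for every affine $\varphi:I\subseteq\mathbb{R}^k\to D$ the germ $S\mapsto\omega_{\varphi_\natural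 S}$ on $\operatorname{Simp}^k(I)$ has $\delta$ equal to $0$, where $\varphi_\natural[p_0\ldots p_k]=[\varphi(p_0)\ldots\varphi(p_k)]$; it is regular if it is nonatomic and closed on $k$-planes (every $0$-germ is regular). For a regular germ $\omega$ one writes $\int_C\omega:=\langle C,\omega\rangle$ for simplices and chains $C$. A $k$-gauge is a nonnegative $k$-germ $\mathsf{v}$; it is uniform if it takes equal values on $k$-simplices $S,S'$ in $D$ that are isometric, i.e. there is an isometry of $\mathbb{R}^d$ mapping the $j$-th vertex of $S$ to the $j$-th vertex of $S'$ for all $j$. $[\omega]_{\mathsf{v}}\in[0,\infty]$ is the infimum of constants $c\ge 0$ with $|\omega_S|\le c\,\mathsf{v}_S$ for all $S$; $\omega\approx_{\mathsf{v}}\tilde\omega$ means $[\omega-\tilde\omega]_{\mathsf{v}}<\infty$. $(\lambda)_\natural S$ is the image of $S$ under $x\mapsto\lambda x$; for a uniform gauge $\langle(2^{-n})_\natural S,\mathsf{v}\rangle$ is understood as the value on any translated copy of $(2^{-n})_\natural S$ contained in $D$. A gauge $\mathsf{v}$ is $r$-Dini ($r\ge0$) if it is uniform and $\lim_{n\to\infty}2^{nr}\langle(2^{-n})_\natural S,\mathsf{v}\rangle=0$ for every simplex $S$ (of the relevant dimension) in $D$. A $k$-germ $\omega$ is sewable if for some $k$-Dini $k$-gauge $\mathsf{v}$ there exists a regular $k$-germ $\operatorname{sew}\omega$ with $\omega\approx_{\mathsf{v}}\operatorname{sew}\omega$ (for $k\in\{0,1,2\}$ such a germ is unique, also independently of the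 choice of $\mathsf{v}$; for $k=0$, $\operatorname{sew}f=f$). *)

(* Defs.v *)
From HB Require Import structures.
From mathcomp Require Import freeg.
From mathcomp Require Import all_boot all_order all_algebra.
From mathcomp Require Import all_classical all_reals all_analysis.

Set Implicit Arguments.
Unset Strict Implicit.
Unset Printing Implicit Defensive.

Import Order.TTheory GRing.Theory Num.Theory.
Import numFieldNormedType.Exports.

Local Open Scope classical_set_scope.
Local Open Scope ring_scope.

Section Simplices.
Context {R : realType}.

(* A tuple [p_0 ... p_k] of points of R^d is the matrix with rows p_0, ..., p_k. *)
Definition conv d k (S : 'M[R]_(k.+1, d)) : set 'rV[R]_d :=
  [set p | exists w : 'rV[R]_k.+1,
     [/\ forall i, 0 <= w 0 i, \sum_i w 0 i = 1 & p = w *m S]].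

(* Simp k D is used as a type through the coercion of sets to types. *)
Definition Simp d k (D : set 'rV[R]_d) : set 'M[R]_(k.+1, d) :=
  [set S | conv S `<=` D].
Arguments Simp {d} k D _.

Definition Chain d k (D : set 'rV[R]_d) := {freeg (Simp k D) / R}.

Definition germ d k (D : set 'rV[R]_d) := Simp k D -> R.

Definition pairing d k (D : set 'rV[R]_d) (C : Chain k D) (w : germ k D) : R :=
  fglift (w : Simp k D -> R^o) C.

Lemma conv_face d k (D : set 'rV[R]_d) (S : 'M[R]_(k.+2, d)) (i : 'I_k.+2) :
  S \in Simp k.+1 D -> (row' i S : 'M[R]_(k.+1, d)) \in Simp k D.
Proof.
move=> /set_mem SD; apply/mem_set => p [w [w0 w1 ->]]; apply: SD.
pose u : 'rV[R]_k.+2 := \row_j oapp (w 0) 0 (unlift i j).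
have uE j : u 0 (lift i j) = w 0 j by rewrite mxE liftK.
have ui : u 0 i = 0 by rewrite mxE unlift_none.
exists u; split.
- by move=> j; rewrite mxE; case: unliftP => //= j' _.
- by rewrite (bigD1_ord i) //= ui add0r -w1; apply: eq_bigr => j _; rewrite uE.
- apply/rowP => j; rewrite !mxE (bigD1_ord i) //= ui mul0r add0r.
  by apply: eq_bigr => l _; rewrite uE mxE.
Qed.

Definition face d k (D : set 'rV[R]_d) (S : Simp k.+1 D) (i : 'I_k.+2) :
  Simp k D := exist _ (row' i (val S) : 'M[R]_(k.+1, d)) (conv_face i (valP S)).

Definition boundary d k (D : set 'rV[R]_d) (S : Simp k.+1 D) : Chain k D :=
  \sum_(i < k.+2) (-1) ^+ i *: << face S i >>.

Definition delta d k (D : set 'rV[R]_d) (w : germ k D) : germ k.+1 D :=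
  fun S => pairing (boundary S) w.

Definition vol d k (S : 'M[R]_(k.+1, d)) : R :=
  let P := \matrix_(i < k) (row (lift ord0 i) S - row ord0 S) in
  (k`!%:R)^-1 * Num.sqrt (\det (P *m P^T)).

Definition nonatomic d k (D : set 'rV[R]_d) (w : germ k D) : Prop :=
  (0 < k)%N -> forall S : Simp k D, vol (val S) = 0 -> w S = 0.

Definition affine_map m d (phi : 'rV[R]_m -> 'rV[R]_d) : Prop :=
  exists (A : 'M[R]_(m, d)) (b : 'rV[R]_d), forall x, phi x = x *m A + b.

Lemma conv_push m d k (I : set 'rV[R]_m) (D : set 'rV[R]_d)
    (phi : 'rV[R]_m -> 'rV[R]_d) (S : 'M[R]_(k.+1, m)) :
  affine_map phi -> phi @` I `<=` D -> S \in Simp k I ->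
  (\matrix_i phi (row i S)) \in Simp k D.
Proof.
move=> [A [b phiE]] phiD /set_mem SI; apply/mem_set => p [w [w0 w1 ->]].
apply: phiD; exists (w *m S); first by apply: SI; exists w.
rewrite phiE -mulmxA [RHS]mulmx_sum_row mulmx_sum_row -[b in LHS]scale1r -w1.
rewrite scaler_suml -big_split /=; apply: eq_bigr => i _.
by rewrite rowK phiE row_mul scalerDr.
Qed.

(* phi_natural S, for phi : I -> D the restriction of an affine map *)
Definition push m d k (I : set 'rV[R]_m) (D : set 'rV[R]_d)
    (phi : 'rV[R]_m -> 'rV[R]_d) (aff : affine_map phi)
    (phiD : phi @` I `<=` D) (S : Simp k I) : Simp k D :=
  exist _ (\matrix_i phi (row i (val S))) (conv_push aff phiD (valP S)).

Definition closed_on_planes d k (D : set 'rV[R]_d) (w : germ k D) : Prop :=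
  forall (I : set 'rV[R]_k) (phi : 'rV[R]_k -> 'rV[R]_d)
    (aff : affine_map phi) (phiD : phi @` I `<=` D) (S : Simp k.+1 I),
    delta (fun T : Simp k I => w (push aff phiD T)) S = 0.

Definition regular_germ d k (D : set 'rV[R]_d) (w : germ k D) : Prop :=
  nonatomic w /\ closed_on_planes w.

(* The integral of w on a chain; only meant for regular w. *)
Definition germ_integral d k (D : set 'rV[R]_d) (C : Chain k D) (w : germ k D) : R :=
  pairing C w.

(* Euclidean norm; the norm `|x| of the library on 'rV[R]_d is the sup norm. *)
Definition enorm d (x : 'rV[R]_d) : R := Num.sqrt (\sum_i x 0 i ^+ 2).

Definition euclidean_isometry d (f : 'rV[R]_d -> 'rV[R]_d) : Prop :=
  forall x y, enorm (f x - f y) = enorm (x - y).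

Definition isometric d k (S S' : 'M[R]_(k.+1, d)) : Prop :=
  exists2 f : 'rV[R]_d -> 'rV[R]_d,
    euclidean_isometry f & forall j, f (row j S) = row j S'.

Definition gauge d k (D : set 'rV[R]_d) (v : germ k D) : Prop :=
  forall S, 0 <= v S.

Definition uniform d k (D : set 'rV[R]_d) (v : germ k D) : Prop :=
  forall S S' : Simp k D, isometric (val S) (val S') -> v S = v S'.

(* S' is a translated copy of the image of S under x |-> c *: x *)
Definition scaled_copy d k (c : R) (S S' : 'M[R]_(k.+1, d)) : Prop :=
  exists a : 'rV[R]_d, forall j, row j S' = c *: row j S + a.

(* Such copies exist inside D, by scaling S about its vertex p_0. *)
Lemma scaled_copy_ex d k (D : set 'rV[R]_d) (n : nat) (S : Simp k D) :
  exists S' : Simp k D, scaled_copy (2 ^- n) (val S) (val S').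
Proof.
set c : R := 2 ^- n; pose S0 := val S.
have c0 : 0 <= c by rewrite invr_ge0 exprn_ge0.
have c1 : c <= 1 by rewrite invf_le1 ?exprn_gt0 // exprn_ege1 // ler1n.
pose a := (1 - c) *: row ord0 S0; pose T := \matrix_j (c *: row j S0 + a).
have TD : T \in Simp k D.
  apply/mem_set => p [w [w0 w1 ->]]; apply: (set_mem (valP S)).
  exists (c *: w + (1 - c) *: delta_mx 0 ord0); split.
  - by move=> i; rewrite !mxE addr_ge0 ?mulr_ge0 ?subr_ge0.
  - under eq_bigr do rewrite !mxE; rewrite big_split -!mulr_sumr w1 /=.
    rewrite (bigD1 ord0) //= big1 ?eqxx ?addr0 ?mulr1 ?subrKC //.
    by move=> i /negbTE ->.
  - rewrite mulmx_sum_row mulmxDl -!scalemxAl -rowE -/a mulmx_sum_row.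
    under eq_bigr do rewrite rowK scalerDr.
    rewrite big_split -scaler_suml w1 scale1r scaler_sumr /=; congr (_ + _).
    by apply: eq_bigr => i _; rewrite !scalerA mulrC.
by exists (exist _ T TD); exists a => j; rewrite rowK.
Qed.

(* v takes a single value on all copies of 2^-n S in D, since it is uniform;
   it is the value of v on any T n as below. *)
Definition dini d k (D : set 'rV[R]_d) (r : R) (v : germ k D) : Prop :=
  [/\ 0 <= r, uniform v &
    forall (S : Simp k D) (T : nat -> Simp k D),
      (forall n, scaled_copy (2 ^- n) (val S) (val (T n))) ->
      (fun n : nat => 2 `^ (n%:R * r) * v (T n)) @ \oo --> (0 : R)].

Definition gauge_seminorm d k (D : set 'rV[R]_d) (v w : germ k D) : \bar R :=
  ereal_inf [set c%:E | c in [set c : R | 0 <= c /\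
    forall S, `|w S| <= c * v S]].

Definition gauge_equiv d k (D : set 'rV[R]_d) (v w w' : germ k D) : Prop :=
  (gauge_seminorm v (fun S => (w S - w' S)%R) < +oo)%E.

Definition is_sewing d k (D : set 'rV[R]_d) (w s : germ k D) : Prop :=
  exists v : germ k D,
    [/\ gauge v, dini k%:R v, regular_germ s & gauge_equiv v w s].

Definition sewable d k (D : set 'rV[R]_d) (w : germ k D) : Prop :=
  exists s, is_sewing w s.

(* A chosen s with is_sewing w s; it is the only one when k is 0, 1 or 2.
   The value is junk when w is not sewable. *)
Definition sew d k (D : set 'rV[R]_d) (w : germ k D) : germ k D :=
  xget (fun=> 0) [set s | is_sewing w s].

End Simplices.

Arguments Simp {R d} k D _.

(* Main.v *)
Require Import Defs.
From HB Require Import structures.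
From mathcomp Require Import freeg polyrcf.
From mathcomp Require Import all_boot all_order all_algebra.
From mathcomp Require Import all_classical all_reals all_analysis.
From mathcomp Require Import zify ring lra.

Set Implicit Arguments.
Unset Strict Implicit.
Unset Printing Implicit Defensive.

Import Order.TTheory GRing.Theory Num.Theory.

Local Open Scope classical_set_scope.
Local Open Scope ring_scope.

(** Let s = sew eta, t = sew (delta eta) and fix a simplex S of dimension k + 1.
    Subdivide S dyadically n times, with signs, in such a way that subdividing
    commutes with taking boundaries ([cobound_refine]): write B for the operator
    that sends a function of simplices to its signed sum over the pieces.
    Nonatomicity and closedness on planes make a regular germ a fixed point of
    B ([refine_regular]), so with e = eta - s and e' = delta eta - t

      delta s S - t S = delta (B^n s) S - B^n t S
                      = B^n e' S - delta (B^n e) S,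

    because the two contributions of eta, B^n (delta eta) S and
    delta (B^n eta) S, cancel.  A simplex of dimension j has 2^(n j) pieces
    after n steps, all isometric to 2^-n times the simplex or to 2^-n times the
    simplex with its vertices in reverse order.  For a germ bounded by a j-Dini
    gauge the values of B^n therefore tend to 0 ([dini_refine_cvg0]).  Apply this
    with j = k + 1 to e', and with j = k to e on the faces of S: the right-hand
    side tends to 0 while the left-hand side does not depend on n.

    For the second part, delta eta is closed on planes because delta delta = 0,
    also after restriction to a plane.  It is nonatomic because a simplex of
    zero volume lies in an affine subspace of dimension k, where the closedness
    of eta says that delta eta vanishes ([nonatomic_delta]).  The Stokes formula is
    then the definition of delta. *)

(** * Coboundaries and closedness on planes *)

Lemma deltaE (R : realType) d k (D : set 'rV[R]_d) (w : germ k D)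
    (S : Simp k.+1 D) :
  delta w S = \sum_(i < k.+2) (-1) ^+ i * w (face S i).
Proof.
rewrite /delta /pairing /boundary.
have add := lift_is_additive (w : Simp k D -> R^o).
pose a := GRing.isAdditive.Build _ _ _ add.
pose F : {additive {freeg (Simp k D) / R} -> R^o} :=
  HB.pack (fglift (w : Simp k D -> R^o)) a.
rewrite -[fglift _]/(F : _ -> _) raddf_sum; apply: eq_bigr => i _.
rewrite -signr_odd; case: odd; rewrite ?expr1 ?expr0.
  by rewrite scaleN1r raddfN /= liftU /GRing.scale /= mul1r mulN1r.
by rewrite scale1r /= liftU /GRing.scale /= mul1r.
Qed.

Lemma pairingU (R : realType) d k (D : set 'rV[R]_d) (w : germ k D)
    (S : Simp k D) : pairing << S >> w = w S.
Proof. by rewrite /pairing liftU /GRing.scale /= mul1r. Qed.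

Lemma face_face (R : realType) d k (D : set 'rV[R]_d) (S : Simp k.+2 D)
    (i : 'I_k.+3) (j : 'I_k.+2) (i' : 'I_k.+3) (j' : 'I_k.+2) :
  (j < i)%N -> i' = j :> nat -> j' = i.-1 :> nat ->
  face (face S i) j = face (face S i') j'.
Proof.
move=> ji ei ej; apply: val_inj; apply/matrixP => r c /=; rewrite !mxE.
congr (val S _ c); apply: val_inj => /=; rewrite ei ej /bump.
by lia.
Qed.

(** The pairs (i, j) with j < i and those with i <= j are exchanged by
    [face_face], with opposite signs. *)
Lemma delta_delta (R : realType) d k (D : set 'rV[R]_d) (w : germ k D)
    (S : Simp k.+2 D) : delta (delta w) S = 0.
Proof.
rewrite deltaE; under eq_bigr do rewrite deltaE mulr_sumr.
rewrite pair_big /= (bigID (fun p : 'I_k.+3 * 'I_k.+2 => (p.2 < p.1)%N)) /=.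
pose h (p : 'I_k.+3 * 'I_k.+2) : 'I_k.+3 * 'I_k.+2 :=
  (widen_ord (leqnSn _) p.2, inord p.1.-1).
pose g (p : 'I_k.+3 * 'I_k.+2) : 'I_k.+3 * 'I_k.+2 :=
  (lift ord0 p.2, inord p.1).
apply/eqP; rewrite addr_eq0 -sumrN; apply/eqP.
rewrite [RHS](reindex_onto h g) /=; last first.
  move=> [i j] /=; rewrite -leqNgt => ij; congr (_, _); apply: val_inj => /=.
    by rewrite inordK // (leq_ltn_trans ij).
  by rewrite add0n inordK.
rewrite [RHS](eq_bigl (fun p : 'I_k.+3 * 'I_k.+2 => (p.2 < p.1)%N)).
  apply: eq_bigr => -[i j] /= ji.
  have i1 : (i.-1 < k.+2)%N by case: i ji => -[].
  rewrite (@face_face _ _ _ _ S i j (widen_ord (leqnSn _) j) (inord i.-1)) //;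
    last by rewrite inordK.
  rewrite !mulrA -!exprD inordK // -mulNr; congr (_ * _).
  have -> : (i + j = (j + i.-1).+1)%N by lia.
  by rewrite exprS mulN1r.
move=> [i j] /=; apply/idP/idP.
  case/andP => ji /eqP[ei _]; have i0 : (0 < i)%N by rewrite -ei.
  have i1 : (i.-1 < k.+2)%N by have := ltn_ord i; lia.
  by move: ji; rewrite inordK //; lia.
move=> ji; have i1 : (i.-1 < k.+2)%N by case: i ji => -[].
rewrite inordK // -leqNgt; apply/andP; split; first by lia.
apply/eqP; congr (_, _); apply: val_inj; rewrite /= ?inordK //.
by rewrite /bump /=; lia.
Qed.

Section ClosedOnPlanes.
Context {R : realType} {d : nat} {D : set 'rV[R]_d}.

Lemma face_push m k (I : set 'rV[R]_m) (phi : 'rV[R]_m -> 'rV[R]_d)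
    (aff : affine_map phi) (phiD : phi @` I `<=` D) (S : Simp k.+1 I)
    (i : 'I_k.+2) :
  push aff phiD (face S i) = face (push aff phiD S) i.
Proof.
apply: val_inj; apply/row_matrixP => j /=; rewrite rowK.
apply/rowP => c; rewrite !mxE; congr (phi _ _ _).
by apply/rowP => l; rewrite !mxE.
Qed.

Lemma delta_push m k (w : germ k D) (I : set 'rV[R]_m)
    (phi : 'rV[R]_m -> 'rV[R]_d) (aff : affine_map phi)
    (phiD : phi @` I `<=` D) (S : Simp k.+1 I) :
  delta (fun T : Simp k I => w (push aff phiD T)) S = delta w (push aff phiD S).
Proof. by rewrite !deltaE; under eq_bigr do rewrite face_push. Qed.

Lemma closed_on_planes_delta k (w : germ k D) : closed_on_planes (delta w).
Proof.
move=> I phi aff phiD S.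
have -> : (fun T : Simp k.+1 I => delta w (push aff phiD T)) =
          delta (fun T : Simp k I => w (push aff phiD T)).
  by apply/funext => T; rewrite delta_push.
exact: delta_delta.
Qed.

(** Closedness is stated through push-forwards; a simplex of D with vertices in
    the image of an affine map is one, of a simplex in the preimage of D. *)
Lemma closed_on_planes_coord k (w : germ k D) (T : Simp k.+1 D)
    (S0 : 'M[R]_(k.+2, k)) (A : 'M[R]_(k, d)) (b : 'rV[R]_d) :
  closed_on_planes w -> (forall i, row i (val T) = row i S0 *m A + b) ->
  delta w T = 0.
Proof.
move=> wcl TE; pose phi (x : 'rV[R]_k) := x *m A + b.
have aff : affine_map phi by exists A, b.
have phiD : phi @` (phi @^-1` D) `<=` D by move=> _ [x ? <-].
have S0I : S0 \in Simp k.+1 (phi @^-1` D).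
  apply/mem_set => _ [u [u0 u1 ->]]; apply: (set_mem (valP T)).
  exists u; split => //; rewrite /phi -mulmxA !mulmx_sum_row.
  rewrite -[b]scale1r -u1 scaler_suml -big_split /=.
  by apply: eq_bigr => i _; rewrite TE row_mul scalerDr.
rewrite -(wcl _ _ aff phiD (exist _ S0 S0I)) delta_push; congr (delta w _).
by apply: val_inj; apply/row_matrixP => i /=; rewrite rowK TE.
Qed.

End ClosedOnPlanes.

(** The characteristic polynomial of - P P^T is nonpositive at 0, so it has a
    root x >= 0.  An eigenvector v satisfies |v P|^2 = - x |v|^2 <= 0, hence
    v P = 0.  In particular the Gram determinant cannot be negative, so that the square
    root in [vol] hides no case. *)
Lemma gram_det_le0 (R : rcfType) m n (P : 'M[R]_(m, n)) :
  \det (P *m P^T) <= 0 -> exists2 v : 'rV_m, v != 0 & v *m P = 0.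
Proof.
move=> det0; pose p := char_poly (- (P *m P^T)).
have p0 : p.[0] <= 0.
  rewrite horner_coef0 char_poly_det -(scaleN1r (P *m P^T)) detZ mulrA -exprD.
  by rewrite addnn -signr_odd odd_double mul1r.
have [b bP] : exists b, forall x, x >= b -> p.[x] >= lead_coef p.
  by apply: poly_pinfty_gt_lc; rewrite (monicP (char_poly_monic _)).
have [x /andP[x0 _]] : exists2 x, 0 <= x <= Num.max 0 b & root p x.
  apply: poly_ivt; rewrite ?le_max ?lexx //= p0 /=.
  apply: le_trans (bP _ _); last by rewrite le_max lexx orbT.
  by rewrite (monicP (char_poly_monic _)).
rewrite -eigenvalue_root_char => /eigenvalueP[v vE v0]; exists v => //.
have sq k (u : 'rV[R]_k) : (u *m u^T) 0 0 = \sum_i u 0 i ^+ 2.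
  by rewrite mxE; apply: eq_bigr => i _; rewrite mxE.
have e : \sum_i (v *m P) 0 i ^+ 2 = - (x * \sum_i v 0 i ^+ 2).
  have /(congr1 -%R) := congr1 (fun u : 'rV_m => (u *m v^T) 0 0) vE.
  rewrite -scalemxAl [in RHS]mxE mulmxN mulNmx [in LHS]mxE opprK.
  by rewrite mulmxA -[v *m P *m _ *m _]mulmxA -trmx_mul !sq.
have s0 : \sum_i (v *m P) 0 i ^+ 2 = 0.
  apply/le_anti; rewrite {1}e oppr_le0 mulr_ge0 ?sumr_ge0 // => *;
    exact: sqr_ge0.
apply/rowP => i; rewrite [RHS]mxE; apply/eqP; rewrite -sqrf_eq0; apply/eqP.
by apply: (psumr_eq0P _ s0) => // j _; exact: sqr_ge0.
Qed.

(** A simplex of zero volume has edge vectors of rank at most k, so its vertices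
    lie in a k-dimensional affine subspace. *)
Lemma nonatomic_delta (R : realType) d k (D : set 'rV[R]_d) (w : germ k D) :
  closed_on_planes w -> nonatomic (delta w).
Proof.
move=> wcl _ S; rewrite /vol; set P := (X in X *m X^T) => vol0.
have : \det (P *m P^T) <= 0.
  move/eqP: vol0; rewrite mulf_eq0 invr_eq0 pnatr_eq0 -leqn0 leqNgt fact_gt0.
  by rewrite /= sqrtr_eq0.
move/gram_det_le0 => [v v0 vP].
have rkP : (\rank P <= k)%N.
  rewrite -ltnS ltn_neqAle rank_leq_row andbT; apply/negP => Pfree.
  by case/negP: v0; apply/eqP; apply: (row_free_inj Pfree); rewrite mul0mx.
(* A rank factorization of the edge vectors, padded to inner dimension k. *)
pose C := col_ebase P *m (pid_mx (\rank P) : 'M[R]_(k.+1, k)).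
pose A := (pid_mx (\rank P) : 'M[R]_(k, d)) *m row_ebase P.
have PE : P = C *m A.
  rewrite /C /A mulmxA -[col_ebase _ *m _ *m _]mulmxA mul_pid_mx minnn.
  by rewrite (minn_idPr rkP) mulmx_ebase.
pose S0 : 'M[R]_(k.+2, k) :=
  \matrix_i oapp (fun j => row j C) 0 (unlift ord0 i).
apply: (closed_on_planes_coord (S0 := S0) (A := A) (b := row ord0 (val S)) wcl).
move=> i; rewrite rowK; case: unliftP => [j ->|->] /=; last first.
  by rewrite mul0mx add0r.
by rewrite -row_mul -PE rowK subrK.
Qed.

Lemma regular_delta (R : realType) d k (D : set 'rV[R]_d) (w : germ k D) :
  regular_germ w -> regular_germ (delta w).
Proof.
case=> _ wcl.
by split; [exact: nonatomic_delta | exact: closed_on_planes_delta].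
Qed.

(** * Signed dyadic subdivision *)

Section Subdivision.
Context {R : realType} {d : nat}.
Implicit Types (p q r a : 'rV[R]_d) (x : seq 'rV[R]_d)
  (f g : seq 'rV[R]_d -> R) (c : R).

Definition midpoint p q : 'rV[R]_d := 2^-1 *: (p + q).

(** The orders of the vertices are chosen so that every inner edge of a triangle
    occurs twice with opposite signs, literally and not up to a permutation of
    its endpoints; this is needed because general germs are not alternating.
    It forces the sign -1 on the middle triangle. *)
Definition subdivision x : seq (R * seq 'rV[R]_d) :=
  match x with
  | [:: p; q] =>
      let m := midpoint p q in [:: (1, [:: p; m]); (1, [:: m; q])]
  | [:: p; q; r] =>
      let m01 := midpoint p q in
      let m02 := midpoint p r in
      let m12 := midpoint q r in
      [:: (1, [:: p; m01; m02]); (1, [:: m01; q; m12]);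
          (1, [:: m02; m12; r]); (-1, [:: m01; m02; m12])]
  | _ => [:: (1, x)]
  end.

Definition refine f x : R := \sum_(y <- subdivision x) y.1 * f y.2.

Definition cobound f x : R :=
  \sum_(i < size x) (-1) ^+ i * f (take i x ++ drop i.+1 x).

Lemma cobound3 f p q r :
  cobound f [:: p; q; r] = f [:: q; r] - f [:: p; r] + f [:: p; q].
Proof. by rewrite /cobound /= !big_ord_recl big_ord0 /bump /=; ring. Qed.

Lemma cobound4 f p q r s :
  cobound f [:: p; q; r; s] =
  f [:: q; r; s] - f [:: p; r; s] + f [:: p; q; s] - f [:: p; q; r].
Proof. by rewrite /cobound /= !big_ord_recl big_ord0 /bump /=; ring. Qed.

(** The subdivision is a chain map: it subdivides the boundary, and the inner
    edges cancel. *)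
Lemma cobound_refine f x : (size x <= 3)%N ->
  cobound (refine f) x = refine (cobound f) x.
Proof.
case: x => [|p [|q [|r [|? ?]]]] // _; rewrite /cobound /refine /=;
  rewrite ?(big_cons, big_nil, big_ord_recl, big_ord0) /=;
  rewrite ?(big_cons, big_nil, big_ord_recl, big_ord0) /=;
  rewrite /bump /= ?expr0 ?expr1 ?sqrrN ?expr1n; ring.
Qed.

Lemma size_subdivision k x : (k <= 2)%N -> size x = k.+1 ->
  size (subdivision x) = (2 ^ k)%N.
Proof.
by move=> k2; case: x => [|p [|q [|r [|? ?]]]] //= [ke]; rewrite -ke in k2 *.
Qed.

Lemma subdivision_norm x y : y \in subdivision x -> `|y.1| = 1.
Proof.
by case: x => [|p [|q [|r [|? ?]]]] /=; rewrite !inE -?orbA => h;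
  repeat (case/orP: h => h); rewrite (eqP h) /= ?normrN normr1.
Qed.

Lemma subdivision_size x y : y \in subdivision x -> size y.2 = size x.
Proof.
by case: x => [|p [|q [|r [|? ?]]]] /=; rewrite !inE -?orbA => h;
  repeat (case/orP: h => h); rewrite (eqP h).
Qed.

Lemma midpointxx p : midpoint p p = p.
Proof. by apply/rowP => i; rewrite !mxE; field. Qed.

Lemma subdivision_vertices x y p : y \in subdivision x -> p \in y.2 ->
  exists q r, [/\ q \in x, r \in x & p = midpoint q r].
Proof.
have idem q z : q \in z -> exists a b, [/\ a \in z, b \in z & q = midpoint a b].
  by move=> qz; exists q, q; rewrite midpointxx.
case: x => [|a [|b [|c [|? ?]]]] /=; rewrite !inE -?orbA => h;
  repeat (case/orP: h => h); rewrite {h}(eqP h) //=; try exact: idem;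
  rewrite !inE -?orbA => h;
  repeat (case/orP: h => h); rewrite {h}(eqP h) //=;
  by [apply: idem; rewrite !inE eqxx ?orbT
     | do 2!eexists; split; last reflexivity; rewrite !inE eqxx ?orbT].
Qed.

(** The reflected and reversed copies are there for the middle triangle: with
    g = (p + q + r) / 2, its vertices m01, m02, m12 are g - r / 2, g - q / 2,
    g - p / 2. *)
Definition copy c x (y : seq 'rV[R]_d) : Prop :=
  exists a, y = [seq c *: p + a | p <- x] \/ y = rev [seq a - c *: p | p <- x].

Local Ltac vec := rewrite /rev /=; repeat (congr (_ :: _));
  by apply/rowP => i; rewrite !mxE; field.

Lemma copy_subdivision c x y z : (size x <= 3)%N -> copy c x y ->
  z \in subdivision y -> copy (c / 2) x z.2.
Proof.
move=> x3 [a yE].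
pose b (t : 'rV[R]_d) := (c / 2) *: t.
have left b' : z.2 = [seq (c / 2) *: p + b' | p <- x] -> copy (c / 2) x z.2.
  by move=> ->; exists b'; left.
have right b' : z.2 = rev [seq b' - (c / 2) *: p | p <- x] ->
    copy (c / 2) x z.2.
  by move=> ->; exists b'; right.
case: x x3 yE left right => [|p [|q [|r [|? ?]]]] // _ [] -> left right.
all: rewrite /= ?/(rev _) /= !inE -?orbA => h;
  repeat (case/orP: h => h); move/eqP: h left right => -> /= left right.
(* Only the empty simplex is settled by the shift 0.  A corner piece at the image
   of p has the shift a + b p in a direct copy and a - b p in a reflected one; the
   middle triangle exchanges direct and reflected copies. *)
all: try by apply: (left 0).
all: first [apply: (left (a + b p)); vec | apply: (left (a + b q)); vec
  | apply: (left (a + b r)); vec | apply: (left (a - b (p + q + r))); vec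
  | apply: (right (a - b p)); vec | apply: (right (a - b q)); vec
  | apply: (right (a - b r)); vec | apply: (right (a + b (p + q + r))); vec].
Qed.

Lemma iter_refineB n f g x :
  iter n refine (fun y => f y - g y) x = iter n refine f x - iter n refine g x.
Proof.
elim: n x => [//|n IHn] x /=; rewrite /refine -sumrB.
by apply: eq_bigr => y _; rewrite IHn mulrBr.
Qed.

Lemma iter_cobound_refine n f x : (size x <= 3)%N ->
  cobound (iter n refine f) x = iter n refine (cobound f) x.
Proof.
elim: n x => [//|n IHn] x x3; rewrite iterS cobound_refine //= /refine.
rewrite !big_seq; apply: eq_bigr => y yx.
by rewrite IHn ?(subdivision_size yx).
Qed.

(** Q m holds of the simplices that can occur after m subdivisions, so that f has
    to be estimated on the small simplices of generation n only. *)
Lemma iter_refine_bound (Q : nat -> seq 'rV[R]_d -> Prop) N f M n :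
  (forall m x, Q m x -> size (subdivision x) = N) ->
  (forall m x y, Q m x -> y \in subdivision x -> Q m.+1 y.2) ->
  (forall x, Q n x -> `|f x| <= M) ->
  forall x, Q 0%N x -> `|iter n refine f x| <= N%:R ^+ n * M.
Proof.
move=> QN QS fM; suff H j m x : (m + j = n)%N -> Q m x ->
    `|iter j refine f x| <= N%:R ^+ j * M by move=> x; apply: H.
elim: j m x => [|j IHj] m x.
  by rewrite addn0 => mn Qx; rewrite mul1r fM -?mn.
move=> mj Qx; rewrite iterS {1}/refine exprS -mulrA.
apply: le_trans (ler_norm_sum _ _ _) _.
set B := _ ^+ j * M; have -> : N%:R * B = \sum_(y <- subdivision x) B.
  by rewrite big_const_seq count_predT iter_addr_0 (QN _ _ Qx) mulr_natl.
rewrite !big_seq; apply: ler_sum => y yx.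
rewrite normrM (subdivision_norm yx) mul1r.
by apply: IHj (QS _ _ _ Qx yx); rewrite addSnnS.
Qed.

Lemma iter_refine_eq (Q : seq 'rV[R]_d -> Prop) f g n x :
  (forall x y, Q x -> y \in subdivision x -> Q y.2) ->
  (forall x, Q x -> f x = g x) -> Q x ->
  iter n refine f x = iter n refine g x.
Proof.
move=> QS fg; elim: n x => [|n IHn] x Qx; first exact: fg.
rewrite /= /refine !big_seq; apply: eq_bigr => y yx.
by rewrite IHn //; exact: QS yx.
Qed.

Lemma iter_refine_id (Q : seq 'rV[R]_d -> Prop) f n x :
  (forall x y, Q x -> y \in subdivision x -> Q y.2) ->
  (forall x, Q x -> refine f x = f x) -> Q x -> iter n refine f x = f x.
Proof.
move=> QS fQ; elim: n x => [//|n IHn] x Qx; rewrite iterSr.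
by rewrite (iter_refine_eq (g := f) _ QS fQ) ?IHn.
Qed.

End Subdivision.

(** * Germs as functions of sequences of points *)

Local Notation conv := Defs.conv.

Section Hull.
Context {R : realType} {d : nat}.

Lemma conv_row k (S : 'M[R]_(k.+1, d)) i : conv S (row i S).
Proof.
exists (delta_mx 0 i); split => [j||]; rewrite -?rowE //.
  by rewrite mxE ler0n.
rewrite (bigD1 i) //= big1 ?mxE ?eqxx ?addr0 //.
by move=> j /negbTE ji; rewrite mxE ji.
Qed.

Lemma conv_midpoint k (S : 'M[R]_(k.+1, d)) p q :
  conv S p -> conv S q -> conv S (midpoint p q).
Proof.
move=> [u [u0 u1 ->]] [v [v0 v1 ->]]; exists (midpoint u v); split.
- by move=> i; rewrite !mxE mulr_ge0 ?addr_ge0 ?invr_ge0.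
- under eq_bigr do rewrite !mxE.
  by rewrite -mulr_sumr big_split /= u1 v1; field.
- by rewrite /midpoint -scalemxAl mulmxDl.
Qed.

Lemma conv_sub k l (S : 'M[R]_(k.+1, d)) (T : 'M[R]_(l.+1, d)) :
  (forall i, conv S (row i T)) -> conv T `<=` conv S.
Proof.
move=> TS _ [u [u0 u1 ->]].
pose W := \matrix_i projT1 (cid (TS i)).
have WP i :
    [/\ forall j, 0 <= W i j, \sum_j W i j = 1 & row i T = row i W *m S].
  rewrite rowK; have [w0 w1 wE] := projT2 (cid (TS i)).
  split=> // [j|]; first by rewrite mxE.
  by under eq_bigr do rewrite mxE.
exists (u *m W); split.
- move=> j; rewrite mxE sumr_ge0 // => i _; rewrite mulr_ge0 //.
  by have [/(_ j)] := WP i.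
- under eq_bigr do rewrite mxE.
  rewrite exchange_big -u1; apply: eq_bigr => i _.
  by rewrite -mulr_sumr; have [_ -> _] := WP i; rewrite mulr1.
- rewrite -mulmxA; congr (_ *m _); apply/row_matrixP => i.
  by rewrite row_mul; have [_ _] := WP i.
Qed.

End Hull.

Section Vertices.
Context {R : realType} {d : nat}.
Implicit Types (x : seq 'rV[R]_d) (D : set 'rV[R]_d).

Definition mx_of k x : 'M[R]_(k.+1, d) := \matrix_i x`_i.

Definition verts k (S : 'M[R]_(k.+1, d)) : seq 'rV[R]_d :=
  mkseq (fun i => row (inord i) S) k.+1.

Lemma size_verts k (S : 'M[R]_(k.+1, d)) : size (verts S) = k.+1.
Proof. exact: size_mkseq. Qed.

Lemma nth_verts k (S : 'M[R]_(k.+1, d)) (i : 'I_k.+1) : (verts S)`_i = row i S.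
Proof. by rewrite nth_mkseq ?inord_val. Qed.

Lemma mx_ofK k x : size x = k.+1 -> verts (mx_of k x) = x.
Proof.
move=> xk; apply: (@eq_from_nth _ 0); rewrite size_verts // => i ik.
by rewrite (nth_verts _ (Ordinal ik)) rowK.
Qed.

Lemma vertsK k (S : 'M[R]_(k.+1, d)) : mx_of k (verts S) = S.
Proof. by apply/row_matrixP => i; rewrite rowK nth_verts. Qed.

Definition is_simplex k D x := size x = k.+1 /\ mx_of k x \in Simp k D.

Lemma is_simplexP k D x :
  is_simplex k D x -> exists S : Simp k D, x = verts (val S).
Proof.
by move=> [xk xD]; exists (exist _ (mx_of k x) xD); rewrite /= mx_ofK.
Qed.

Lemma verts_is_simplex k D (S : Simp k D) : is_simplex k D (verts (val S)).
Proof. by split; [rewrite size_verts | rewrite vertsK; exact: valP]. Qed.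

Lemma is_simplex_sub k l D x y : is_simplex k D x -> size y = l.+1 ->
  (forall p, p \in y -> conv (mx_of k x) p) -> is_simplex l D y.
Proof.
move=> [_ /set_mem xD] yl yx; split=> //; apply/mem_set.
apply: subset_trans xD; apply: conv_sub => i; rewrite rowK.
by apply: yx; rewrite mem_nth ?yl.
Qed.

Lemma conv_vertex k x p : size x = k.+1 -> p \in x -> conv (mx_of k x) p.
Proof.
move=> xk px; have ik : (index p x < k.+1)%N by rewrite -xk index_mem.
have -> : p = row (Ordinal ik) (mx_of k x) by rewrite rowK /= nth_index.
exact: conv_row.
Qed.

Lemma is_simplex_subdivision k D x y :
  is_simplex k D x -> y \in subdivision x -> is_simplex k D y.2.
Proof.
move=> xD yx; have xk := proj1 xD.
apply: is_simplex_sub xD _ _; first by rewrite (subdivision_size yx).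
move=> p /(subdivision_vertices yx)[q [r [qx rx ->]]].
by apply: conv_midpoint; exact: conv_vertex.
Qed.

(** Extension by 0, so that [refine] and [cobound] apply to germs without
    carrying proofs that the pieces and the faces lie in D. *)
Definition germ_at k D (w : germ k D) x : R :=
  oapp (w : Simp k D -> R) 0 (insub (mx_of k x)).

Lemma germ_at_verts k D (w : germ k D) (S : Simp k D) :
  germ_at w (verts (val S)) = w S.
Proof. by rewrite /germ_at vertsK valK. Qed.

Lemma verts_face k D (S : Simp k.+1 D) (i : 'I_k.+2) :
  verts (val (face S i)) = take i (verts (val S)) ++ drop i.+1 (verts (val S)).
Proof.
have sz : size (take i (verts (val S)) ++ drop i.+1 (verts (val S))) = k.+1.
  have ik := ltn_ord i.
  by rewrite size_cat size_take size_drop size_verts ik; lia.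
apply: (@eq_from_nth _ 0); rewrite size_verts // => j jk.
rewrite (nth_verts _ (Ordinal jk)).
have -> : row (Ordinal jk) (val (face S i)) =
          row (lift i (Ordinal jk)) (val S) by apply/rowP => c; rewrite !mxE.
rewrite -nth_verts nth_cat size_take size_verts ltn_ord /= /bump leqNgt.
case: ltnP => ij /=.
  by rewrite nth_take.
by rewrite nth_drop; congr (_`__); lia.
Qed.

Lemma cobound_verts k D f (S : Simp k.+1 D) :
  cobound f (verts (val S)) =
  \sum_(i < k.+2) (-1) ^+ i * f (verts (val (face S i))).
Proof.
by rewrite /cobound size_verts; apply: eq_bigr => i _; rewrite verts_face.
Qed.

Lemma cobound_germ_at k D (w : germ k D) (S : Simp k.+1 D) :
  cobound (germ_at w) (verts (val S)) = delta w S.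
Proof.
by rewrite deltaE cobound_verts; apply: eq_bigr => i _; rewrite germ_at_verts.
Qed.

(** The k + 1 vertices of x span an affine subspace of dimension at most k;
    barycentric coordinates, without the first one, parametrize it. *)
Lemma flat_cobound k D (w : germ k D) x y : closed_on_planes w ->
  is_simplex k D x -> size y = k.+2 ->
  (forall p, p \in y -> conv (mx_of k x) p) -> cobound (germ_at w) y = 0.
Proof.
move=> wcl xD yk yx; have [T yT] := is_simplexP (is_simplex_sub xD yk yx).
rewrite yT cobound_germ_at.
have Tx i : conv (mx_of k x) (row i (val T)).
  by rewrite -nth_verts -yT; apply: yx; rewrite mem_nth ?yk.
pose X := mx_of k x.
have [W WP] : exists W : 'M[R]_(k.+2, k.+1),
    forall i, \sum_j W i j = 1 /\ row i (val T) = row i W *m X.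
  exists (\matrix_i projT1 (cid (Tx i))) => i.
  rewrite rowK; have [_ w1 wE] := projT2 (cid (Tx i)).
  by split=> //; under eq_bigr do rewrite mxE.
pose A := \matrix_(i < k) (row (lift ord0 i) X - row ord0 X).
apply: (closed_on_planes_coord (S0 := col' ord0 W) (A := A)
  (b := row ord0 X)) => // i.
have [W1 ->] := WP i; rewrite !mulmx_sum_row.
under [in RHS]eq_bigr do rewrite rowK scalerBr !mxE.
rewrite sumrB -scaler_suml big_ord_recl /= !mxE.
move: W1; rewrite big_ord_recl /= => /(canRL (addrK _)) ->.
rewrite scalerBl scale1r [RHS]addrC [RHS]addrCA [RHS]addrC; congr (_ + _).
by apply: eq_bigr => j _; rewrite !mxE.
Qed.

End Vertices.

(** * Regular germs are fixed by subdivision *)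

Section Invariance.
Context {R : realType} {d : nat}.
Implicit Types (x : seq 'rV[R]_d) (p q r : 'rV[R]_d) (D : set 'rV[R]_d).

(** The edge vectors v, 2 v of this triangle are killed by the row (2, -1). *)
Lemma vol_midpoint p q : vol (mx_of 2 [:: p; midpoint p q; q]) = 0.
Proof.
rewrite /vol; set P := (X in X *m X^T).
suff -> : \det (P *m P^T) = 0 by rewrite sqrtr0 mulr0.
apply/eqP/det0P; pose u : 'rV[R]_2 := \row_i (if i == ord0 then 2 else -1).
exists u.
  apply/eqP => /rowP/(_ ord0)/eqP.
  by rewrite /u !mxE /= pnatr_eq0.
rewrite mulmxA [u *m P](_ : _ = 0) ?mul0mx //.
apply/rowP => i; rewrite /u /P !mxE !big_ord_recl big_ord0 ?mxE /= ?mxE.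
by field.
Qed.

(** For a segment, [p m q] is a degenerate triangle in a line, and closedness
    says that the germ is additive.  For a triangle, the closedness on four
    tetrahedra with apex p expresses the pieces through cones from p over
    subdivided edges.  The cones over inner edges cancel, and the degenerate
    triangles [a m b], on which the germ vanishes, merge the rest. *)
Lemma refine_regular k D (w : germ k D) x : (k <= 2)%N -> regular_germ w ->
  is_simplex k D x -> refine (germ_at w) x = germ_at w x.
Proof.
move=> k2 [wat wcl] xD; have xk := proj1 xD.
have flat y : size y = k.+2 -> (forall p, p \in y -> conv (mx_of k x) p) ->
    cobound (germ_at w) y = 0 by exact: flat_cobound.
have vx p := @conv_vertex _ _ k x p xk.
have mid p q := @conv_midpoint _ _ _ (mx_of k x) p q.
case: x xk xD flat vx mid => [|p [|q [|r [|? ?]]]] //= [kE]; subst k => //.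
- by rewrite /refine /= big_seq1 mul1r.
- move=> _ flat vx mid; have := flat [:: p; midpoint p q; q].
  rewrite cobound3 /refine /= !big_cons big_nil /= => h.
  have {}h := h erefl; suff : germ_at w [:: midpoint p q; q] -
    germ_at w [:: p; q] + germ_at w [:: p; midpoint p q] = 0 by lra.
  apply: h => t; rewrite !inE => /or3P[]/eqP->; do ?apply: mid; apply: vx;
    by rewrite !inE eqxx ?orbT.
- move=> xD flat vx mid.
  have [xp xq xr] : [/\ conv (mx_of 2 [:: p; q; r]) p,
      conv (mx_of 2 [:: p; q; r]) q & conv (mx_of 2 [:: p; q; r]) r].
    by split; apply: vx; rewrite !inE eqxx ?orbT.
  have tetra a b c e : conv (mx_of 2 [:: p; q; r]) a ->
      conv (mx_of 2 [:: p; q; r]) b -> conv (mx_of 2 [:: p; q; r]) c ->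
      conv (mx_of 2 [:: p; q; r]) e ->
      germ_at w [:: b; c; e] - germ_at w [:: a; c; e] + germ_at w [:: a; b; e]
      - germ_at w [:: a; b; c] = 0.
    move=> xa xb xc xe; rewrite -cobound4; apply: flat => //.
    by move=> t; rewrite !inE => /or4P[]/eqP->.
  have degenerate a b : conv (mx_of 2 [:: p; q; r]) a ->
      conv (mx_of 2 [:: p; q; r]) b ->
      germ_at w [:: a; midpoint a b; b] = 0.
    move=> xa xb.
    have [|S e] := @is_simplexP _ _ 2 D [:: a; midpoint a b; b].
      apply: is_simplex_sub xD _ _ => //.
      by move=> t; rewrite !inE => /or3P[]/eqP->; do ?apply: mid.
    rewrite e germ_at_verts; apply: wat => //.
    by rewrite -[val S]vertsK -e; exact: vol_midpoint.
  set m01 := midpoint p q; set m02 := midpoint p r; set m12 := midpoint q r.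
  have x01 : conv (mx_of 2 [:: p; q; r]) m01 by exact: mid.
  have x02 : conv (mx_of 2 [:: p; q; r]) m02 by exact: mid.
  have x12 : conv (mx_of 2 [:: p; q; r]) m12 by exact: mid.
  have := tetra p q m12 r xp xq x12 xr.
  have := tetra p m01 q m12 xp x01 xq x12.
  have := tetra p m02 m12 r xp x02 x12 xr.
  have := tetra p m01 m02 m12 xp x01 x02 x12.
  have := degenerate p q xp xq; have := degenerate p r xp xr.
  have := degenerate q r xq xr; rewrite -/m01 -/m02 -/m12.
  rewrite /refine /= !big_cons big_nil /= -/m01 -/m02 -/m12.
  lra.
Qed.

End Invariance.

(** * Decay of iterated subdivisions under Dini gauges *)

Section Decay.
Import numFieldNormedType.Exports.
Context {R : realType} {d : nat}.
Implicit Types (x : seq 'rV[R]_d) (p q r : 'rV[R]_d) (D : set 'rV[R]_d).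

Lemma uniform_congruent k D (v : germ k D) (S S' : Simp k D) (s : bool) a :
  uniform v ->
  (forall j, row j (val S') = (-1) ^+ s *: row j (val S) + a) -> v S' = v S.
Proof.
move=> vuni SS'; apply/esym/vuni.
exists (fun y => (-1) ^+ s *: y + a) => // y z.
rewrite /enorm; congr Num.sqrt; apply: eq_bigr => i _.
by rewrite opprD addrACA subrr addr0 -scalerBr mxE exprMn -exprM mulnC exprM
  sqrrN !expr1n mul1r.
Qed.

Lemma gauge_copy k D (v : germ k D) c (S rS T rT P : Simp k D) :
  uniform v -> verts (val rS) = rev (verts (val S)) ->
  scaled_copy c (val S) (val T) -> scaled_copy c (val rS) (val rT) ->
  copy c (verts (val S)) (verts (val P)) -> v P = v T \/ v P = v rT.
Proof.
move=> vuni rSE [b TE] [b' rTE] [a [] PE]; [left|right].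
  apply: (@uniform_congruent _ _ _ _ _ false (a - b)) => // j.
  rewrite -nth_verts PE (nth_map 0) ?size_verts // nth_verts TE.
  by rewrite expr0 scale1r addrACA subrr addr0.
apply: (@uniform_congruent _ _ _ _ _ true (a + b')) => // j.
rewrite -nth_verts PE -map_rev -rSE (nth_map 0) ?size_verts // nth_verts rTE.
by rewrite expr1 scaleN1r opprD addrACA addNr addr0 addrC.
Qed.

Lemma rev_simplex k D (S : Simp k D) :
  exists rS : Simp k D, verts (val rS) = rev (verts (val S)).
Proof.
have SD := verts_is_simplex S.
have [|rS ->] := @is_simplexP _ _ k D (rev (verts (val S))); last by exists rS.
apply: is_simplex_sub SD _ _; first by rewrite size_rev size_verts.
by move=> p; rewrite mem_rev; apply: conv_vertex; rewrite size_verts.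
Qed.

(** There are 2^(n k) pieces, and on each of them v takes its value on the copy
    of S or on the copy of the reversed simplex at scale 2^-n; so the Dini
    condition at these two simplices suffices. *)
Lemma dini_refine_cvg0 k D (w v : germ k D) c (S : Simp k D) : (k <= 2)%N ->
  dini k%:R v -> (forall T, `|w T| <= c * v T) ->
  iter n refine (germ_at w) (verts (val S)) @[n --> \oo] --> (0 : R).
Proof.
move=> k2 [_ vuni vlim] wv; have [rS rSE] := rev_simplex S.
have [T TE] := choice (fun n => scaled_copy_ex n S).
have [rT rTE] := choice (fun n => scaled_copy_ex n rS).
have bound n : `|iter n refine (germ_at w) (verts (val S))| <=
    (2 ^ k)%:R ^+ n * (c * v (T n) + c * v (rT n)).
  apply: (@iter_refine_bound _ _ (fun m x =>
    is_simplex k D x /\ copy (2 ^- m) (verts (val S)) x) _ _ _ n) => //.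
  - by move=> m x [[xk _] _]; exact: size_subdivision.
  - move=> m x y [xD xS] yx; split; first exact: is_simplex_subdivision yx.
    by rewrite exprSr invfM; apply: copy_subdivision yx; rewrite ?size_verts.
  - move=> x [/is_simplexP[P ->] PS]; rewrite germ_at_verts.
    have pos Q : 0 <= c * v Q by apply: le_trans (wv Q).
    apply: le_trans (wv P) _.
    have [->|->] := gauge_copy vuni rSE (TE n) (rTE n) PS.
      by rewrite lerDl.
    by rewrite lerDr.
  - split; first exact: verts_is_simplex.
    exists 0; left; rewrite expr0 invr1 -[LHS]map_id.
    by apply: eq_map => p; rewrite scale1r addr0.
have lim0 (U : nat -> Simp k D) (S' : Simp k D) :
    (forall n, scaled_copy (2 ^- n) (val S') (val (U n))) ->
    (2 ^ k)%:R ^+ n * (c * v (U n)) @[n --> \oo] --> (0 : R).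
  move=> UE; rewrite -[0 in X in _ --> X](mulr0 c).
  under eq_fun do rewrite mulrCA.
  apply: cvgMr; have := vlim S' U UE.
  under eq_fun do rewrite (mulrC _ k%:R) powRrM !powR_mulrn ?ler0n //.
  by rewrite natrX; exact.
apply/norm_cvg0P; apply: (@squeeze_cvgr _ _ _ _ (cst 0)
  (fun n => (2 ^ k)%:R ^+ n * (c * v (T n)) +
            (2 ^ k)%:R ^+ n * (c * v (rT n)))).
- by apply: nearW => n /=; rewrite normr_ge0 -mulrDr bound.
- exact: cvg_cst.
- by rewrite -[0 in X in _ --> X]addr0; apply: cvgD; apply: lim0.
Qed.

Lemma gauge_equiv_bound k D (v w w' : germ k D) : gauge_equiv v w w' ->
  exists c, forall S, `|w S - w' S| <= c * v S.
Proof. by move=> /ereal_inf_lt[_ [c [_ cP] <-] _]; exists c. Qed.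

(** After n subdivisions the terms of eta cancel between S and its boundary.
    There remain the error of the (k + 1)-germ on 2^(n (k + 1)) pieces of S and
    that of the k-germ on 2^(n k) pieces of each face: each Dini condition has
    exactly the exponent that its number of pieces requires. *)
Lemma delta_sewing k D (eta s : germ k D) (t : germ k.+1 D) : (k <= 1)%N ->
  is_sewing eta s -> is_sewing (delta eta) t -> delta s = t.
Proof.
move=> k1 [v [_ vdini sreg /gauge_equiv_bound[c sv]]].
move=> [v' [_ v'dini treg /gauge_equiv_bound[c' tv]]]; apply/funext => S.
pose e : germ k D := fun T => eta T - s T.
pose e' : germ k.+1 D := fun T => delta eta T - t T.
have germ_atB j (w w' : germ j D) :
    germ_at (fun T => w T - w' T) = fun x => germ_at w x - germ_at w' x.
  by apply/funext => x; rewrite /germ_at; case: insub => //=; rewrite subr0.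
have key n : delta s S - t S = iter n refine (germ_at e') (verts (val S)) -
    \sum_(i < k.+2)
      (-1) ^+ i * iter n refine (germ_at e) (verts (val (face S i))).
  have id j (w : germ j D) (P : Simp j D) : (j <= 2)%N -> regular_germ w ->
      iter n refine (germ_at w) (verts (val P)) = w P.
    move=> j2 wreg; rewrite (iter_refine_id (Q := is_simplex j D)).
    - exact: germ_at_verts.
    - by move=> x y; exact: is_simplex_subdivision.
    - by move=> x; exact: refine_regular.
    - exact: verts_is_simplex.
  rewrite germ_atB iter_refineB (id _ t S) //.
  rewrite (iter_refine_eq (Q := is_simplex k.+1 D)
    (g := cobound (germ_at eta))).
  - rewrite -iter_cobound_refine ?size_verts // cobound_verts deltaE.
    rewrite addrAC; congr (_ - _); rewrite -sumrB; apply: eq_bigr => i _.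
    rewrite germ_atB iter_refineB (id _ s) ?(leq_trans k1) //; ring.
  - by move=> x y; exact: is_simplex_subdivision.
  - by move=> x /is_simplexP[P ->]; rewrite germ_at_verts cobound_germ_at.
  - exact: verts_is_simplex.
apply/eqP; rewrite -subr_eq0; apply/eqP.
have lim : (fun n : nat => delta s S - t S) @ \oo --> (0 : R).
  rewrite (funext key).
  rewrite -[0 in X in _ --> X](subr0 0); apply: cvgB.
    exact: dini_refine_cvg0 v'dini tv.
  rewrite [X in _ --> X](_ : 0 = \sum_(i < k.+2) (-1) ^+ i * 0).
    apply: cvg_big => [|i _]; first exact: add_continuous.
    apply: cvgMr.
    by apply: dini_refine_cvg0 vdini sv; rewrite (leq_trans k1).
  by rewrite big1 // => i _; rewrite mulr0.
by apply: (cvg_unique _ (cvg_cst _) lim).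
Qed.

End Decay.

Theorem theorem3p18 (R : realType) (d : nat) (D : set 'rV[R]_d) (k : nat)
    (hk : k.+1 = 1%N \/ k.+1 = 2%N) :
  (forall eta : germ k D, sewable eta -> sewable (delta eta) ->
     delta (sew eta) = sew (delta eta))
  /\
  (forall eta : germ k D, regular_germ eta ->
     regular_germ (delta eta) /\
     forall S : Simp k.+1 D,
       germ_integral (boundary S) eta = germ_integral << S >> (delta eta)).
Proof.
have k1 : (k <= 1)%N by case: hk => -[->].
split=> [eta eta_sew deta_sew|eta eta_reg].
  by apply: (delta_sewing k1 (eta := eta)); exact: xgetPex.
split=> [|S]; first exact: regular_delta.
by rewrite /germ_integral pairingU.
Qed.
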